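(* Let $G=(V,E)$ be a connected graph with $n$ nodes and $m$ edges, and let $r\in V$. Run the content-oblivious BFS algorithm $\mathcal{A}$ with root $r$ in the asynchronous model, under arbitrary finite message delays, non-FIFO delivery, and arbitrary corruption of message contents. Then $\mathcal{A}$ terminates, and the following hold. - The edges $\{u,\mathrm{parent}_u\}$ for $u\neq r$ form a BFS tree $\mathcal{T}$ of $G$ rooted at $r$: every node $u\neq r$ at distance $k$ from $r$ has $\mathrm{parent}_u$ equal to a neighbour at distance $k-1$ from $r$. - At the end, for every node $u$, $\mathrm{children}_u=\{v:\mathrm{parent}_v=u\}$. Thus each node knows its parent and all its incident edges in $\mathcal{T}$. - The algorithm sends $O(nm)$ messages in total.
   Context: Asynchronous model: there are no timing assumptions, and messages are not necessarily delivered in FIFO order. A node is asleep until it receives a message. On receiving one, it performs local computation, sends zero or more messages to neighbours, and goes back to sleep. Each node knows $n$ and its neighbour set $\mathcal{N}_u$. Algorithm $\mathcal{A}$ (content-oblivious BFS). Nodes ignore the contents of all messages; decisions depend only on from which neighbour a message arrives. Every node $u$ has variables $\mathrm{state}_u\in\{\mathsf{INIT},\mathsf{IDLE},\mathsf{EXPLORE},\mathsf{DONE}\}$, $\mathrm{parent}_u$, $\mathrm{children}_u$ and $\mathrm{count}_u$. All nodes start in $\mathsf{INIT}$. The root $r$ sets $\mathrm{parent}_r=\bot$, $\mathrm{children}_r=\mathcal{N}_r$, $\mathrm{count}_r=0$ and $\mathrm{state}_r=\mathsf{IDLE}$. It then repeatedly invokes Explore until $\mathrm{state}_r=\mathsf{DONE}$.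 The nodes handle incoming messages as follows. (i) SetParent: a node $u$ in $\mathsf{INIT}$ that receives a message from $v$ sets $\mathrm{parent}_u=v$, $\mathrm{children}_u=\mathcal{N}_u\setminus\{v\}$, $\mathrm{count}_u=0$ and $\mathrm{state}_u=\mathsf{IDLE}$, and sends a message to $v$. (ii) MarkSibling: a node $u$ in $\mathsf{IDLE}$ or $\mathsf{DONE}$ that receives a message from some $v\neq\mathrm{parent}_u$ removes $v$ from $\mathrm{children}_u$ and sends a message to $v$. (iii) Explore: a node $u$ in $\mathsf{IDLE}$ that receives a message from $\mathrm{parent}_u$ (or the root, when it invokes Explore) proceeds as follows. - It sets $\mathrm{state}_u=\mathsf{EXPLORE}$ and increments $\mathrm{count}_u$. - Sequentially, for each $v\in\mathcal{N}_u\setminus\{\mathrm{parent}_u\}$, it sends a message to $v$ and waits until it receives a message from $v$. - If $\mathrm{count}_u=n-1$, it performs an extra ''dummy'' exploration: sequentially, for each $v\in\mathrm{children}_u$, it sends a message to $v$ and waits for a message from $v$. - It then sends a message to $\mathrm{parent}_u$; the root skips this step. - Finally it sets $\mathrm{state}_u=\mathsf{DONE}$ if $\mathrm{count}_u=n-1$, and $\mathrm{state}_u=\mathsf{IDLE}$ otherwise.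
   Formalization: The graph is assumed to have n ≥ 2 nodes; for n = 1 the root's count becomes 1 on its first Explore and never equals n − 1 = 0, so the algorithm as described never terminates. *)

(* Defs.v *)
From mathcomp Require Import all_boot.
Set Implicit Arguments.
Unset Strict Implicit.
Unset Printing Implicit Defensive.

Section Model.
Variable V : finType.
Variable adj : rel V.      (* simple undirected graph: symmetric, irreflexive *)
Variable r : V.

Definition nbrs (u : V) : {set V} := [set v | adj u v].
Definition n_nodes : nat := #|V|.
Definition n_edges : nat := #|[set [set p.1; p.2] | p in [set p : V * V | adj p.1 p.2]]|.

Definition is_dist (s u : V) (k : nat) : Prop :=
  (exists p : seq V, path adj s p /\ last s p = u /\ size p = k) /\
  (forall p : seq V, path adj s p -> last s p = u -> k <= size p).

Inductive status := INIT | IDLE | EXPLORE | DONE.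
(* phase of an ongoing Explore: regular loop over N_u \ {parent_u},
   or the extra dummy loop over children_u *)
Inductive phase := Reg | Dum.

Record nstate := NState {
  st : status;
  par : option V;
  chl : {set V};
  cnt : nat;
  ph : phase;
  todo : {set V};
  await : option V
}.

(* Messages carry no content (the algorithm is content-oblivious, so
   arbitrary corruption of contents is immaterial); a message is just a
   (sender, receiver) pair. The network is a multiset (seq) of in-transit
   messages, any of which may be delivered next (non-FIFO, arbitrary
   finite delays). [sent] counts all messages ever sent. *)
Record config := Config {
  ns : V -> nstate;
  net : seq (V * V);
  sent : nat
}.

Definition upd (c : config) (u : V) (s : nstate) (msgs : seq (V * V)) : config :=
  Config (fun x => if x == u then s else ns c x) (msgs ++ net c) (size msgs + sent c).

Definition pset (o : option V) : {set V} :=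
  match o with Some p => [set p] | None => set0 end.

Definition start_explore (u : V) (s : nstate) : nstate :=
  NState EXPLORE (par s) (chl s) (cnt s).+1 Reg (nbrs u :\: pset (par s)) None.

Definition init_state (u : V) : nstate :=
  if u == r then NState IDLE None (nbrs r) 0 Reg set0 None
  else NState INIT None set0 0 Reg set0 None.

Definition init_config : config := Config init_state [::] 0.

Inductive step : config -> config -> Prop :=
| StepRootExplore c :
    st (ns c r) = IDLE ->
    step c (upd c r (start_explore r (ns c r)) [::])
| StepSetParent c v u :
    (v, u) \in net c -> st (ns c u) = INIT ->
    step c (upd (Config (ns c) (rem (v, u) (net c)) (sent c)) u
              (NState IDLE (Some v) (nbrs u :\ v) 0 Reg set0 None) [:: (u, v)])
| StepMarkSibling c v u :
    (v, u) \in net c -> (st (ns c u) = IDLE \/ st (ns c u) = DONE) ->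
    par (ns c u) <> Some v ->
    let s := ns c u in
    step c (upd (Config (ns c) (rem (v, u) (net c)) (sent c)) u
              (NState (st s) (par s) (chl s :\ v) (cnt s) (ph s) (todo s) (await s))
              [:: (u, v)])
| StepExplore c v u :
    (v, u) \in net c -> st (ns c u) = IDLE -> par (ns c u) = Some v ->
    step c (upd (Config (ns c) (rem (v, u) (net c)) (sent c)) u
              (start_explore u (ns c u)) [::])
| StepReceiveAwaited c v u :
    (v, u) \in net c -> st (ns c u) = EXPLORE -> await (ns c u) = Some v ->
    let s := ns c u in
    step c (upd (Config (ns c) (rem (v, u) (net c)) (sent c)) u
              (NState EXPLORE (par s) (chl s) (cnt s) (ph s) (todo s) None) [::])
| StepSendNext c u w :
    st (ns c u) = EXPLORE -> await (ns c u) = None -> w \in todo (ns c u) ->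
    let s := ns c u in
    step c (upd c u (NState EXPLORE (par s) (chl s) (cnt s) (ph s) (todo s :\ w) (Some w))
              [:: (u, w)])
| StepStartDummy c u :
    st (ns c u) = EXPLORE -> await (ns c u) = None -> ph (ns c u) = Reg ->
    todo (ns c u) = set0 -> cnt (ns c u) = n_nodes - 1 ->
    let s := ns c u in
    step c (upd c u (NState EXPLORE (par s) (chl s) (cnt s) Dum (chl s) None) [::])
| StepFinish c u :
    st (ns c u) = EXPLORE -> await (ns c u) = None -> todo (ns c u) = set0 ->
    (ph (ns c u) = Dum \/ cnt (ns c u) <> n_nodes - 1) ->
    let s := ns c u in
    step c (upd c u
              (NState (if cnt s == n_nodes - 1 then DONE else IDLE)
                      (par s) (chl s) (cnt s) Reg set0 None)
              (match par s with Some p => [:: (u, p)] | None => [::] end)).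

Inductive reachable : config -> Prop :=
| reach_init : reachable init_config
| reach_step c c' : reachable c -> step c c' -> reachable c'.

Definition terminal (c : config) : Prop := forall c', ~ step c c'.

End Model.

(* Main.v *)
Require Import Defs.
From mathcomp Require Import all_boot.
From mathcomp Require Import zify.
Set Implicit Arguments.
Unset Strict Implicit.
Unset Printing Implicit Defensive.

(** Control is sequential: the exploring nodes form a branch of the tree hanging
    from the root, each waiting for the next one, and the last one [t] holds the
    token: it is computing, or a single message travels between [t] and the node
    it awaits.  A child has completed exactly one exploration less than its
    parent (up to the phase of the parent's loop, and until the dummy loops even
    the counts out), so a node at depth [d] starts exploring only after all nodes
    within distance [d] have a parent.  Hence a new node is always attached to a neighbour one layer above it; and since two
    neighbours differ by at most one in depth, the token is never sent to an
    exploring node, so there is no deadlock.  Termination and the message count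
    both follow from a potential, initially [O(nm)], that every step decreases. *)

(** * Distances from the root, and the degree sum *)

Section Graph.
Variables (V : finType) (adj : rel V) (r : V).

Lemma is_dist_inj s u k l : is_dist adj s u k -> is_dist adj s u l -> k = l.
Proof.
move=> [[p [pP [lp <-]]] mk] [[q [qP [lq <-]]] ml].
by apply/eqP; rewrite eqn_leq mk ?ml.
Qed.

Lemma is_dist_lt s u k : is_dist adj s u k -> k < #|V|.
Proof.
move=> [[p [pP [lp _]]] mk].
case/shortenP: pP lp => q qP uq _ lq.
by apply: leq_ltn_trans (mk q qP lq) _; rewrite -[_.+1](card_uniqP uq) max_card.
Qed.

Lemma dist_exists :
  (forall v, connect adj r v) -> exists D, forall v, is_dist adj r v (D v).
Proof.
move=> conn; apply: fin_all_exists => v.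
have ex : exists k, [exists p : k.-tuple V, path adj r p && (last r p == v)].
  have /connectP[p pP lp] := conn v; exists (size p); apply/existsP.
  by exists (in_tuple p); rewrite pP lp eqxx.
exists (ex_minn ex); case: ex_minnP => k /existsP[p /andP[pP /eqP lp]] mk.
split; first by exists p; rewrite size_tuple.
move=> q qP lq; apply: mk; apply/existsP.
by exists (in_tuple q); rewrite qP lq eqxx.
Qed.

Variable D : V -> nat.
Hypothesis DP : forall v, is_dist adj r v (D v).

Lemma dist_root : D r = 0.
Proof. by apply/eqP; rewrite -leqn0; apply: (DP r).2 [::] _ _. Qed.

Lemma dist_eq0 v : D v = 0 -> v = r.
Proof.
move=> Dv; have [[p [_ [lp sp]]] _] := DP v; move: sp lp; rewrite Dv.
by case: p => // _ /= ->.
Qed.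

Lemma dist_adj u v : adj u v -> D v <= (D u).+1.
Proof.
move=> uv; have [[p [pP [lp <-]]] _] := DP u.
rewrite -(size_rcons p v); apply: (DP v).2; last by rewrite last_rcons.
by rewrite rcons_path pP lp.
Qed.

Lemma dist_pred v k : D v = k.+1 -> exists2 p, adj p v & D p = k.
Proof.
move=> Dv; have [[p [+ [+ +]]] _] := DP v; rewrite Dv.
case/lastP: p => // p x; rewrite last_rcons size_rcons rcons_path.
move=> /andP[pP pv] xv [sp]; rewrite xv in pv; exists (last r p) => //.
have := dist_adj pv; rewrite Dv ltnS => kD; apply/eqP.
by rewrite eqn_leq kD andbT -sp; apply: (DP _).2.
Qed.

End Graph.

(** The degree sum counts ordered adjacent pairs, and all pairs with endpoint set [e] lie in [e]
    times [e], which has at most four elements. *)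
Lemma card_adj_pairs (V : finType) (adj : rel V) :
  \sum_u #|nbrs adj u| <= 4 * n_edges adj.
Proof.
have -> : \sum_u #|nbrs adj u| = #|[set p : V * V | adj p.1 p.2]|.
  under eq_bigr => u _ do rewrite -sum1_card big_mkcond.
  rewrite pair_bigA /= -sum1_card [RHS]big_mkcond /=.
  by apply: eq_bigr => -[u v] _; rewrite !inE.
set S := [set p | _]; rewrite /n_edges -/S; set T := [set _ | _ in _].
pose h (p : V * V) : {set V} := [set p.1; p.2].
have hS p : p \in S -> h p \in T by move=> pS; apply/imsetP; exists p.
rewrite -sum1_card (partition_big h (mem T)) //= mulnC -sum_nat_const.
apply: leq_sum => e /imsetP[q qS ->]; rewrite sum1_card.
apply: (@leq_trans #|setX [set q.1; q.2] [set q.1; q.2]|).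
  apply/subset_leq_card/subsetP => p /andP[_ /eqP pq].
  by rewrite -pq inE !inE !eqxx orbT.
by rewrite cardsX cards2; case: (_ != _).
Qed.

(** * The ledger of explorations and the global invariant *)

Section Invariant.
Variables (V : finType) (adj : rel V) (r : V).
Hypotheses (adj_sym : symmetric adj) (adj_irr : irreflexive adj).
Variable D : V -> nat.
Hypothesis DP : forall v, is_dist adj r v (D v).

(** Convertible to the states of [upd], so that the preservation lemmas speak of states and network
    alone, without the counter [sent]. *)
Definition setn (f : V -> nstate V) x s := fun y => if y == x then s else f y.

(* Past the last regular loop: every tree child is owed one extra exploration. *)
Definition late (s : nstate V) : bool :=
  match st s, ph s with DONE, _ | EXPLORE, Dum => true | _, _ => false end.

(* Number of completed regular loops. *)
Definition rounds (s : nstate V) : nat :=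
  match st s, ph s with EXPLORE, Reg => (cnt s).-1 | _, _ => cnt s end.

(* In its current loop, [u] has not yet sent to [v], or [v] has not yet received. *)
Definition pending (f : V -> nstate V) (net : seq (V * V)) u v : bool :=
  (v \in todo (f u)) || (await (f u) == Some v) && ((u, v) \in net).

(* No exploration message from [u] has ever been received by [v]; meant for a
   neighbour [v] of [u] other than its parent. *)
Definition fresh f net u v : Prop :=
  cnt (f u) = 0 \/
  [/\ st (f u) = EXPLORE, ph (f u) = Reg, cnt (f u) = 1 & pending f net u v].

(** [cnt] is incremented when an exploration starts, hence positive while exploring. The strict
    bound at [IDLE] says that one more exploration is due, which lets [weight] decrease when it
    starts. *)
Definition cnt_ok (s : nstate V) : Prop :=
  match st s with
  | INIT => True
  | IDLE => cnt s < #|V| - 1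
  | EXPLORE => 0 < cnt s <= #|V| - 1 /\ (ph s = Dum -> cnt s = #|V| - 1)
  | DONE => cnt s = #|V| - 1
  end.

Definition quiet (f : V -> nstate V) (net : seq (V * V)) : Prop :=
  (forall u, st (f u) <> EXPLORE) /\ net = [::].

(** The last clause lists three moments: [t] computes, its request travels to [w], or the answer of
    [w] travels back. If the request makes [w] explore, [w] takes over the token, so the node
    awaited by the holder is never exploring. *)
Definition token (f : V -> nstate V) (net : seq (V * V)) (t : V) : Prop :=
  [/\ st (f t) = EXPLORE,
      forall u, st (f u) = EXPLORE -> u <> t -> exists v,
        [/\ await (f u) = Some v, st (f v) = EXPLORE & par (f v) = Some u] &
      (await (f t) = None /\ net = [::]) \/
      exists w, [/\ await (f t) = Some w, st (f w) <> EXPLORE &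
        net = [:: (t, w)] \/ net = [:: (w, t)] /\ st (f w) <> INIT]].

(** [inv_par] holds the BFS property and [inv_count] the ledger: a child lags by one because the
    message that attached it started no exploration, and the dummy loop makes up for this. By
    [inv_sib], [chl u] can contain a node that is not a tree child only until the first exploration
    message of that node arrives at [u]. [inv_stack] and [inv_ctrl] describe the branch of exploring
    nodes. *)
Record inv (f : V -> nstate V) (net : seq (V * V)) : Prop := Inv {
  inv_root : par (f r) = None /\ st (f r) <> INIT;
  inv_init u : st (f u) = INIT ->
    [/\ par (f u) = None, cnt (f u) = 0 & chl (f u) = set0];
  inv_rest u : st (f u) <> EXPLORE -> todo (f u) = set0 /\ await (f u) = None;
  inv_par u p : par (f u) = Some p ->
    [/\ adj p u, D u = (D p).+1 & st (f p) <> INIT];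
  inv_tree u : u <> r -> st (f u) <> INIT -> exists p, par (f u) = Some p;
  inv_cnt u : cnt_ok (f u);
  inv_todo u v : v \in todo (f u) -> adj u v /\ par (f u) <> Some v;
  inv_awt u v : await (f u) = Some v ->
    [/\ adj u v, par (f u) <> Some v & v \notin todo (f u)];
  inv_chl u v : v \in chl (f u) -> adj u v /\ par (f u) <> Some v;
  inv_unseen u v : adj u v -> st (f v) = INIT -> fresh f net u v;
  inv_sib u v : v \in chl (f u) -> par (f v) <> Some u -> fresh f net v u;
  inv_chlI u v : adj u v -> st (f v) = INIT -> st (f u) <> INIT ->
    v \in chl (f u);
  inv_chlP u v : par (f v) = Some u -> v \in chl (f u);
  inv_count u p : par (f u) = Some p ->
    cnt (f p) = cnt (f u) + pending f net p u + ~~ late (f p);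
  inv_stack u : st (f u) = EXPLORE -> u <> r -> exists p,
    [/\ par (f u) = Some p, st (f p) = EXPLORE & await (f p) = Some u];
  inv_ctrl : quiet f net \/ exists t, token f net t
}.

(** * Depth, counts and control in a configuration satisfying the invariant *)

Section Consequences.
Variables (f : V -> nstate V) (net : seq (V * V)).
Hypothesis I : inv f net.

Lemma dist_le_card v : D v <= #|V| - 1.
Proof. by have := is_dist_lt (DP v); lia. Qed.

Lemma late_cnt u : late (f u) -> cnt (f u) = #|V| - 1.
Proof.
have := inv_cnt I u; rewrite /cnt_ok /late; case: (st (f u)) => //.
by case: (ph (f u)) => // -[_ /(_ erefl)].
Qed.

Lemma cnt_le u : cnt (f u) <= #|V| - 1.
Proof.
have := inv_cnt I u; rewrite /cnt_ok.
by case E: (st (f u)) => //; [have [_ -> _] := inv_init I E| | |]; lia.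
Qed.

Lemma explore_parent p u : par (f u) = Some p -> st (f u) = EXPLORE ->
  st (f p) = EXPLORE /\ await (f p) = Some u.
Proof.
move=> pu su; have ur : u <> r by move=> ur; move: pu; rewrite ur (inv_root I).1.
by have [p' [+ sp ap]] := inv_stack I su ur; rewrite pu => -[->].
Qed.

(** The only message in transit has an end that is not exploring, whereas [p] and [u] both explore;
    so no message from [p] to [u] is on its way. *)
Lemma explore_not_pending p u :
  par (f u) = Some p -> st (f u) = EXPLORE -> pending f net p u = false.
Proof.
move=> pu su; have [sp ap] := explore_parent pu su.
have [_ _ /negPf ntd] := inv_awt I ap; rewrite /pending ntd ap eqxx /=.
case: (inv_ctrl I) => [[/(_ u)]//|[t [st_t _]]].
case=> [[_ ->]//|[w [aw sw [->|[-> _]]]]]; rewrite inE; apply/negP => /eqP[] E1 E2.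
  by rewrite -E2 in sw.
by rewrite -E1 in sw.
Qed.

(** [inv_count] allows a difference of two in [cnt], but only during a regular loop of [p] that has
    yet to reach [u], and [rounds] does not count that loop. If [u] is exploring, nothing is
    pending, which offsets the loop that [u] has not completed. *)
Lemma rounds_par p u : par (f u) = Some p -> rounds (f p) <= (rounds (f u)).+1.
Proof.
move=> pu; have C := inv_count I pu; have NP := explore_not_pending pu.
have SP s := (explore_parent pu s).1.
have Q : rounds (f u) >= cnt (f u) - (if st (f u) is EXPLORE then 1 else 0).
  by rewrite /rounds; case: (st (f u)); case: (ph (f u)); lia.
have R := @inv_rest _ _ I p.
have PR : st (f p) <> EXPLORE -> pending f net p u = false.
  by case/R=> R1 R2; rewrite /pending R1 R2 inE.
move: (pending f net p u) (rounds (f u)) C Q NP SP PR => b k; rewrite /rounds /late.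
case: (st (f p)) => /=; case: (ph (f p)) => /=; case: (st (f u)) => /= C Q NP SP PR;
  try (have {}NP := NP erefl; subst b); try (by have := SP erefl);
  try (have {}PR : b = false by [apply: PR]; subst b); move: C Q; try case: b {NP PR} => /=;
  lia.
Qed.

Lemma explored_nbr u v : 0 < rounds (f u) -> adj u v -> st (f v) <> INIT.
Proof.
move=> + uv sv; have := inv_unseen I uv sv; rewrite /rounds.
case=> [->|[-> -> -> _]] //; by case: (st (f u)); case: (ph (f u)).
Qed.

(** Induction on depth. A predecessor [q] of [v] has completed at least one round, so [v] has been
    reached. The tree parent [p] of [v], possibly another node, lies in the same layer as [q], and
    passing from [p] to [v] loses at most one round. *)
Lemma rounds_ge v : D v <= rounds (f r) ->
  st (f v) <> INIT /\ rounds (f r) <= rounds (f v) + D v.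
Proof.
move Dv: (D v) => k; elim: k v Dv => [|k IH] v Dv lk.
  rewrite (dist_eq0 DP Dv).
  by split; [case: (inv_root I)|lia].
have [q qv Dq] := dist_pred DP Dv.
have [_ rq] := IH q Dq (ltnW lk).
have sv : st (f v) <> INIT by apply: explored_nbr qv; lia.
have vr : v <> r by move=> vr; move: Dv; rewrite vr (dist_root DP).
have [p pv] := inv_tree I vr sv.
have [_ Dvp _] := inv_par I pv.
have [_ rp] := IH p ltac:(lia) (ltnW lk).
by split => //; have := rounds_par pv; lia.
Qed.

(** Going down a tree edge loses at least one count unless the parent is late, and no node is late
    before the root. *)
Lemma cnt_dist u : st (f u) <> INIT -> late (f r) \/ cnt (f u) + D u <= cnt (f r).
Proof.
move Du: (D u) => k; elim: k u Du => [|k IH] u Du su.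
  rewrite (dist_eq0 DP Du).
  by right; lia.
have ur : u <> r by move=> ur; move: Du; rewrite ur (dist_root DP).
have [p pu] := inv_tree I ur su.
have [_ Dup sp] := inv_par I pu.
have [|H] := IH p ltac:(lia) sp; first by left.
have C := inv_count I pu.
case lp : (late (f p)) C => /= C; last by right; lia.
(* A late [p] other than the root has count [#|V| - 1] and positive depth, so the induction
   hypothesis would push the count of the root above [#|V| - 1]. *)
have cr := cnt_le r; have cp := late_cnt lp.
have [pr|/eqP pr] := eqVneq p r; first by left; rewrite -pr.
have [q pq] := inv_tree I pr sp; have [_ Dpq _] := inv_par I pq.
lia.
Qed.

Lemma late_rounds u : late (f u) -> rounds (f u) = cnt (f u).
Proof. by rewrite /late /rounds; case: (st (f u)) => //; case: (ph (f u)). Qed.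

Lemma rounds_cnt u : cnt (f u) <= (rounds (f u)).+1.
Proof. by rewrite /rounds; case: (st (f u)); case: (ph (f u)); lia. Qed.

(** Unless the root is late, a started exploration at [u] gives the root a count of at least
    [D u + 1], hence [D u] completed rounds. A late root has completed [#|V| - 1] rounds, which
    bounds every distance. *)
Lemma layer_seen u v : 0 < cnt (f u) -> D v <= D u -> st (f v) <> INIT.
Proof.
move=> cu Dvu; apply: (rounds_ge _).1.
have su : st (f u) <> INIT by move=> /(inv_init I)[_ c0]; rewrite c0 in cu.
have [lr|] := cnt_dist su; last by have := rounds_cnt r; lia.
by rewrite late_rounds // late_cnt // dist_le_card.
Qed.

Lemma explore_root u : st (f u) = EXPLORE ->
  st (f r) = EXPLORE /\ (u <> r -> await (f r) <> None).
Proof.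
move Du: (D u) => k; elim: k u Du => [|k IH] u Du su.
  by have ur := dist_eq0 DP Du; rewrite -{1}ur.
have ur : u <> r by move=> ur; move: Du; rewrite ur (dist_root DP).
have [p [pu sp ap]] := inv_stack I su ur.
have [_ Dup _] := inv_par I pu.
have [sr ar] := IH p ltac:(lia) sp; split=> // _.
by have [pr|/eqP/ar//] := eqVneq p r; rewrite -pr ap.
Qed.

(** An exploring node awaits a single node, so the stack hanging from the root cannot branch. *)
Lemma explore_layer u v :
  st (f u) = EXPLORE -> st (f v) = EXPLORE -> D u = D v -> u = v.
Proof.
move Du: (D u) => k; elim: k u v Du => [|k IH] u v Du su sv Dv.
  by rewrite (dist_eq0 DP Du) (dist_eq0 DP (esym Dv)).
have nr w : D w = k.+1 -> w <> r by move=> + wr; rewrite wr (dist_root DP).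
have [p [pu sp ap]] := inv_stack I su (nr _ Du).
have [q [qv sq aq]] := inv_stack I sv (nr _ (esym Dv)).
have [_ Dup _] := inv_par I pu; have [_ Dvq _] := inv_par I qv.
have pq : p = q by apply: IH => //; lia.
by move: ap; rewrite pq aq => -[].
Qed.

(** Neighbours differ by at most one in depth. An exploring [w] one layer above [t] would be its
    parent, one layer below it would be awaited by [t], and in the same layer it would be [t]
    itself. *)
Lemma token_target t w : st (f t) = EXPLORE -> await (f t) = None ->
  adj t w -> par (f t) <> Some w -> st (f w) <> EXPLORE.
Proof.
move=> se at0 tw npw sw.
have Dwt := dist_adj DP tw.
have Dtw : D t <= (D w).+1 by apply: (dist_adj DP); rewrite adj_sym.
have nr x y : D x < D y -> y <> r by move=> + yr; rewrite yr (dist_root DP).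
have [E|E|E] := ltngtP (D w) (D t).
- have [p [pt sp ap]] := inv_stack I se (nr _ _ E); have [_ Dtp _] := inv_par I pt.
  by apply: npw; rewrite pt (explore_layer sw sp) //; lia.
- have [p [pw sp ap]] := inv_stack I sw (nr _ _ E); have [_ Dwp _] := inv_par I pw.
  have pt : p = t by apply: explore_layer => //; lia.
  by move: ap; rewrite pt at0.
- by move: tw; rewrite (explore_layer sw se E) adj_irr.
Qed.

Lemma idle_root_quiet : st (f r) <> EXPLORE -> quiet f net.
Proof. by move=> sr; case: (inv_ctrl I) => // -[t [/explore_root[]]]. Qed.


Lemma explore_idle u : st (f u) = EXPLORE -> await (f u) = None ->
  token f net u /\ net = [::].
Proof.
move=> su au; case: (inv_ctrl I) => [[/(_ u)]//|[t T]]; have [st_t ch N] := T.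
have [ut|/eqP ut] := eqVneq u t; last first.
  by have [v []] := ch u su ut; rewrite au.
by subst t; split=> //; case: N => [[]|[w []]] //; rewrite au.
Qed.

(** The status of the receiver alone tells the two kinds of messages apart: what reaches a node that
    is not exploring is a request of the token holder, what reaches an exploring node is the answer
    it awaits. *)
Lemma request_sender v u : (v, u) \in net -> st (f u) <> EXPLORE ->
  [/\ token f net v, st (f v) = EXPLORE, await (f v) = Some u & net = [:: (v, u)]].
Proof.
move=> vu su; case: (inv_ctrl I) => [[_ N]|[t T]]; first by rewrite N in vu.
have [st_t _ N] := T; case: N => [[_ N]|[w [aw sw [N|[N _]]]]]; move: vu; rewrite N // inE.
  by case/eqP=> -> ->; rewrite -N.
by case/eqP=> _ E; rewrite E in su.
Qed.

Lemma reply_receiver v u : (v, u) \in net -> st (f u) = EXPLORE ->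
  [/\ token f net u, await (f u) = Some v, st (f v) <> EXPLORE,
      st (f v) <> INIT & net = [:: (v, u)]].
Proof.
move=> vu su; case: (inv_ctrl I) => [[_ N]|[t T]]; first by rewrite N in vu.
have [st_t _ N] := T; case: N => [[_ N]|[w [aw sw [N|[N ?]]]]]; move: vu; rewrite N // inE.
  by case/eqP=> _ E; rewrite -E su in sw.
by case/eqP=> -> ->; rewrite -N.
Qed.

Lemma pendingE u v : (u, v) \notin net -> pending f net u v = (v \in todo (f u)).
Proof. by rewrite /pending => /negPf->; rewrite andbF orbF. Qed.

End Consequences.

(** * Preservation of the invariant *)

(** Only the pair [(t, w)] is affected: it may cease to be fresh. No clause constrains it any more,
    since [t] leaves [chl w] and [w] is neither in [INIT] nor a child of [t]. Nor is [t] a child of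
    [w], so removing it is safe. *)
Lemma sibling_step f t w s : inv f [:: (t, w)] -> st (f w) = IDLE \/ st (f w) = DONE ->
  par (f w) <> Some t ->
  s = NState (st (f w)) (par (f w)) (chl (f w) :\ t) (cnt (f w)) (ph (f w))
        (todo (f w)) (await (f w)) ->
  inv (setn f w s) [:: (w, t)].
Proof.
move=> I sw pwt Es.
have swE : st (f w) <> EXPLORE by case: sw => ->.
have [T ste awt _] := request_sender I (mem_head _ _) swE.
have [tw ptw _] := inv_awt I awt.
have wt : w <> t by move=> E; rewrite E in swE.
set g := setn f w s.
have gst y : st (g y) = st (f y) by rewrite /g /setn Es; case: eqP => [->|].
have gpar y : par (g y) = par (f y) by rewrite /g /setn Es; case: eqP => [->|].
have gcnt y : cnt (g y) = cnt (f y) by rewrite /g /setn Es; case: eqP => [->|].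
have gph y : ph (g y) = ph (f y) by rewrite /g /setn Es; case: eqP => [->|].
have gtodo y : todo (g y) = todo (f y) by rewrite /g /setn Es; case: eqP => [->|].
have gaw y : await (g y) = await (f y) by rewrite /g /setn Es; case: eqP => [->|].
have gchl y v : v \in chl (g y) -> v \in chl (f y) /\ ~ (y = w /\ v = t).
  rewrite /g /setn Es; case: eqP => [->|yw] /=; last by move=> ?; split=> // -[].
  by rewrite in_setD1 => /andP[/eqP vt ->]; split=> // -[].
have gchlN y v : v \in chl (f y) -> ~ (y = w /\ v = t) -> v \in chl (g y).
  rewrite /g /setn Es; case: eqP => [->|yw] //= vw nt.
  by rewrite in_setD1 vw andbT; apply/eqP => vt; apply: nt.
have glate y : late (g y) = late (f y) by rewrite /late gst gph.
have gpend y v : ~ (y = t /\ v = w) -> pending g [:: (w, t)] y v = pending f [:: (t, w)] y v.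
  move=> n; rewrite /pending gtodo gaw; congr (_ || _).
  rewrite !inE !xpair_eqE.
  have -> : (y == t) && (v == w) = false by apply/negP => /andP[/eqP ? /eqP ?]; apply: n.
  have [->|] := eqVneq y w; last by [].
  by have [_ ->] := inv_rest I swE.
have gfresh y v : ~ (y = t /\ v = w) -> fresh f [:: (t, w)] y v -> fresh g [:: (w, t)] y v.
  by move=> n; rewrite /fresh gst gph gcnt gpend.
split.
- by rewrite gpar gst; exact: (inv_root I).
- move=> u; rewrite gst gpar gcnt => su; have [p0 c0 h0] := inv_init I su; split=> //.
  by apply/setP => v; rewrite inE; apply/negP => /gchl[]; rewrite h0 inE.
- by move=> u; rewrite gst gtodo gaw; exact: (inv_rest I).
- by move=> u p; rewrite gpar gst; exact: (inv_par I).
- by move=> u; rewrite gpar gst; exact: (inv_tree I).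
- by move=> u; rewrite /cnt_ok gst gcnt gph; exact: (inv_cnt I).
- by move=> u v; rewrite gpar gtodo; exact: (inv_todo I).
- by move=> u v; rewrite gpar gtodo gaw; exact: (inv_awt I).
- by move=> u v /gchl[+ _]; rewrite gpar; exact: (inv_chl I).
- move=> u v uv; rewrite gst => sv; apply: gfresh; last exact: (inv_unseen I).
  by move=> [_ vw]; move: sv; rewrite vw; case: sw => ->.
- move=> u v /gchl[vu n]; rewrite gpar => pv; apply: gfresh; last exact: (inv_sib I).
  by move=> [? ?]; apply: n.
- move=> u v uv; rewrite !gst => sv su; apply: gchlN; first exact: (inv_chlI I).
  by move=> [_ vt]; rewrite vt ste in sv.
- move=> u v; rewrite gpar => pv; apply: gchlN; first exact: (inv_chlP I).
  by move=> [uw vt]; apply: ptw; rewrite -uw -vt.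
- move=> u p; rewrite gpar !gcnt glate => pu; rewrite gpend; first exact: (inv_count I).
  by move=> [pt uw]; apply: pwt; rewrite -uw -pt.
- move=> u; rewrite gst => su ur; have [p [? ? ?]] := inv_stack I su ur.
  by exists p; rewrite gpar gst gaw.
- right; exists t; have [_ ch _] := T; split; first by rewrite gst.
    move=> u; rewrite gst => su ut; have [v [? ? ?]] := ch u su ut.
    by exists v; rewrite gaw gst gpar.
  right; exists w; rewrite gaw gst; split=> //; right; split=> //.
  by case: sw => ->.
Qed.

Lemma receive_step f t w s : inv f [:: (w, t)] -> st (f t) = EXPLORE ->
  s = NState EXPLORE (par (f t)) (chl (f t)) (cnt (f t)) (ph (f t)) (todo (f t)) None ->
  inv (setn f t s) [::].
Proof.
move=> I ste Es.
have [T awt sw swI _] := reply_receiver I (mem_head _ _) ste.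
have wt : w <> t by move=> E; rewrite E in sw.
set g := setn f t s.
have gst y : st (g y) = st (f y) by rewrite /g /setn Es; case: eqP => [->|].
have gpar y : par (g y) = par (f y) by rewrite /g /setn Es; case: eqP => [->|].
have gcnt y : cnt (g y) = cnt (f y) by rewrite /g /setn Es; case: eqP => [->|].
have gph y : ph (g y) = ph (f y) by rewrite /g /setn Es; case: eqP => [->|].
have gtodo y : todo (g y) = todo (f y) by rewrite /g /setn Es; case: eqP => [->|].
have gchl y : chl (g y) = chl (f y) by rewrite /g /setn Es; case: eqP => [->|].
have gawt : await (g t) = None by rewrite /g /setn Es eqxx.
have gaw y : y <> t -> await (g y) = await (f y) by rewrite /g /setn; case: eqP.
have gpend y v : pending g [::] y v = pending f [:: (w, t)] y v.
  rewrite /pending gtodo andbF orbF inE xpair_eqE; have [->|] := eqVneq y w.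
    by have [_ ->] := inv_rest I sw; rewrite /= orbF.
  by rewrite andbF orbF.
have gfresh y v : fresh f [:: (w, t)] y v -> fresh g [::] y v.
  by rewrite /fresh gst gph gcnt gpend.
split.
- by rewrite gpar gst; exact: (inv_root I).
- by move=> u; rewrite gst gpar gcnt gchl; exact: (inv_init I).
- move=> u; rewrite gst gtodo => /(inv_rest I)[-> a0]; split=> //.
  by case: (eqVneq u t) => [->//|/eqP ut]; rewrite gaw.
- by move=> u p; rewrite gpar gst; exact: (inv_par I).
- by move=> u; rewrite gpar gst; exact: (inv_tree I).
- by move=> u; rewrite /cnt_ok gst gcnt gph; exact: (inv_cnt I).
- by move=> u v; rewrite gpar gtodo; exact: (inv_todo I).
- move=> u v; rewrite gpar gtodo; case: (eqVneq u t) => [->|/eqP ut].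
    by rewrite gawt.
  by rewrite gaw //; exact: (inv_awt I).
- by move=> u v; rewrite gchl gpar; exact: (inv_chl I).
- by move=> u v uv; rewrite gst => sv; apply: gfresh; exact: (inv_unseen I).
- by move=> u v; rewrite gchl gpar => vu pv; apply: gfresh; exact: (inv_sib I).
- by move=> u v uv; rewrite !gst gchl; exact: (inv_chlI I).
- by move=> u v; rewrite gpar gchl; exact: (inv_chlP I).
- by move=> u p; rewrite gpar !gcnt gpend /late gst gph; exact: (inv_count I).
- move=> u; rewrite gst => su ur; have [p [pu sp ap]] := inv_stack I su ur.
  exists p; rewrite gpar gst gaw // => pt.
  by move: ap; rewrite pt awt => -[wu]; rewrite wu in sw.
- right; exists t; have [_ ch _] := T; split; first by rewrite gst.
    move=> u; rewrite gst => su ut; have [v [? ? ?]] := ch u su ut.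
    by exists v; rewrite gaw // gst gpar.
  by left.
Qed.

Lemma send_step f t w s : inv f [::] -> st (f t) = EXPLORE -> await (f t) = None ->
  w \in todo (f t) ->
  s = NState EXPLORE (par (f t)) (chl (f t)) (cnt (f t)) (ph (f t))
        (todo (f t) :\ w) (Some w) ->
  inv (setn f t s) [:: (t, w)].
Proof.
move=> I ste awt wtodo Es.
have [T _] := explore_idle I ste awt.
have [tw ptw] := inv_todo I wtodo.
have sw := token_target I ste awt tw ptw.
set g := setn f t s.
have gst y : st (g y) = st (f y) by rewrite /g /setn Es; case: eqP => [->|].
have gpar y : par (g y) = par (f y) by rewrite /g /setn Es; case: eqP => [->|].
have gcnt y : cnt (g y) = cnt (f y) by rewrite /g /setn Es; case: eqP => [->|].
have gph y : ph (g y) = ph (f y) by rewrite /g /setn Es; case: eqP => [->|].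
have gchl y : chl (g y) = chl (f y) by rewrite /g /setn Es; case: eqP => [->|].
have gawt : await (g t) = Some w by rewrite /g /setn Es eqxx.
have gtodot : todo (g t) = todo (f t) :\ w by rewrite /g /setn Es eqxx.
have gN y : y <> t -> g y = f y by rewrite /g /setn; case: eqP.
have gpend y v : pending g [:: (t, w)] y v = pending f [::] y v.
  rewrite /pending andbF orbF inE xpair_eqE; have [->|/eqP yt] := eqVneq y t.
    rewrite gawt gtodot in_setD1 /=; have [->|vw] := eqVneq v w; first by rewrite eqxx wtodo.
    by rewrite /= andbF orbF.
  by rewrite gN //= andbF orbF.
have gfresh y v : fresh f [::] y v -> fresh g [:: (t, w)] y v.
  by rewrite /fresh gst gph gcnt gpend.
split.
- by rewrite gpar gst; exact: (inv_root I).
- by move=> u; rewrite gst gpar gcnt gchl; exact: (inv_init I).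
- move=> u; rewrite gst => su; rewrite gN; first exact: (inv_rest I).
  by move=> ut; rewrite ut in su.
- by move=> u p; rewrite gpar gst; exact: (inv_par I).
- by move=> u; rewrite gpar gst; exact: (inv_tree I).
- by move=> u; rewrite /cnt_ok gst gcnt gph; exact: (inv_cnt I).
- move=> u v; rewrite gpar; case: (eqVneq u t) => [->|/eqP ut].
    by rewrite gtodot in_setD1 => /andP[_]; exact: (inv_todo I).
  by rewrite gN //; exact: (inv_todo I).
- move=> u v; rewrite gpar; case: (eqVneq u t) => [->|/eqP ut].
    by rewrite gawt gtodot => -[<-]; rewrite in_setD1 eqxx.
  by rewrite gN //; exact: (inv_awt I).
- by move=> u v; rewrite gchl gpar; exact: (inv_chl I).
- by move=> u v uv; rewrite gst => sv; apply: gfresh; exact: (inv_unseen I).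
- by move=> u v; rewrite gchl gpar => vu pv; apply: gfresh; exact: (inv_sib I).
- by move=> u v uv; rewrite !gst gchl; exact: (inv_chlI I).
- by move=> u v; rewrite gpar gchl; exact: (inv_chlP I).
- move=> u p; rewrite gpar !gcnt gpend /late gst gph; exact: (inv_count I).
- move=> u; rewrite gst => su ur; have [p [pu sp ap]] := inv_stack I su ur.
  exists p; rewrite gpar gst gN // => pt.
  by move: ap; rewrite pt awt.
- right; exists t; have [_ ch _] := T; split; first by rewrite gst.
    move=> u; rewrite gst => su ut; have [v [? ? ?]] := ch u su ut.
    by exists v; rewrite gN // gst gpar.
  by right; exists w; rewrite gst; split=> //; left.
Qed.

(** The ledger balances because [t] becomes late at the same moment as all its tree children become
    pending. *)
Lemma dummy_step f t s : inv f [::] -> st (f t) = EXPLORE -> await (f t) = None ->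
  ph (f t) = Reg -> todo (f t) = set0 -> cnt (f t) = #|V| - 1 ->
  s = NState EXPLORE (par (f t)) (chl (f t)) (cnt (f t)) Dum (chl (f t)) None ->
  inv (setn f t s) [::].
Proof.
move=> I ste awt pht todot cntt Es.
have [T _] := explore_idle I ste awt.
set g := setn f t s.
have gst y : st (g y) = st (f y) by rewrite /g /setn Es; case: eqP => [->|].
have gpar y : par (g y) = par (f y) by rewrite /g /setn Es; case: eqP => [->|].
have gcnt y : cnt (g y) = cnt (f y) by rewrite /g /setn Es; case: eqP => [->|].
have gchl y : chl (g y) = chl (f y) by rewrite /g /setn Es; case: eqP => [->|].
have gaw y : await (g y) = await (f y) by rewrite /g /setn Es; case: eqP => [->|].
have gtodot : todo (g t) = chl (f t) by rewrite /g /setn Es eqxx.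
have gpht : ph (g t) = Dum by rewrite /g /setn Es eqxx.
have gN y : y <> t -> g y = f y by rewrite /g /setn; case: eqP.
have pend0 v : pending f [::] t v = false by rewrite /pending todot awt inE.
have gfresh y v : fresh f [::] y v -> fresh g [::] y v.
  rewrite /fresh gcnt; case=> [->|]; first by left.
  have [->|/eqP yt] := eqVneq y t; first by rewrite pend0 => -[].
  by rewrite /pending gN //; right.
split.
- by rewrite gpar gst; exact: (inv_root I).
- by move=> u; rewrite gst gpar gcnt gchl; exact: (inv_init I).
- move=> u; rewrite gst => su; rewrite gN; first exact: (inv_rest I).
  by move=> ut; rewrite ut in su.
- by move=> u p; rewrite gpar gst; exact: (inv_par I).
- by move=> u; rewrite gpar gst; exact: (inv_tree I).
- move=> u; have [->|/eqP ut] := eqVneq u t; last by rewrite gN //; exact: (inv_cnt I).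
  by have := inv_cnt I t; rewrite /cnt_ok gst ste gcnt => -[-> _].
- move=> u v; rewrite gpar; case: (eqVneq u t) => [->|/eqP ut].
    by rewrite gtodot; exact: (inv_chl I).
  by rewrite gN //; exact: (inv_todo I).
- move=> u v; rewrite gpar gaw; case: (eqVneq u t) => [->|/eqP ut].
    by rewrite awt.
  by rewrite gN //; exact: (inv_awt I).
- by move=> u v; rewrite gchl gpar; exact: (inv_chl I).
- by move=> u v uv; rewrite gst => sv; apply: gfresh; exact: (inv_unseen I).
- by move=> u v; rewrite gchl gpar => vu pv; apply: gfresh; exact: (inv_sib I).
- by move=> u v uv; rewrite !gst gchl; exact: (inv_chlI I).
- by move=> u v; rewrite gpar gchl; exact: (inv_chlP I).
- move=> u p; rewrite gpar !gcnt => pu; have := inv_count I pu.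
  have [pt|/eqP pt] := eqVneq p t; last by rewrite /pending gN.
  rewrite pt in pu *; rewrite pend0 /late gst gpht ste pht.
  by rewrite /pending gtodot (inv_chlP I pu) /= !addn0.
- move=> u; rewrite gst => su ur; have [p [pu sp ap]] := inv_stack I su ur.
  by exists p; rewrite gpar gst gaw.
- right; exists t; have [_ ch _] := T; split; first by rewrite gst.
    move=> u; rewrite gst => su ut; have [v [? ? ?]] := ch u su ut.
    by exists v; rewrite gaw // gst gpar.
  by left; rewrite gaw.
Qed.

Lemma finish_step f t s : inv f [::] -> st (f t) = EXPLORE -> await (f t) = None ->
  todo (f t) = set0 -> ph (f t) = Dum \/ cnt (f t) <> #|V| - 1 ->
  s = NState (if cnt (f t) == #|V| - 1 then DONE else IDLE) (par (f t)) (chl (f t))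
        (cnt (f t)) Reg set0 None ->
  inv (setn f t s) (if par (f t) is Some p then [:: (t, p)] else [::]).
Proof.
move=> I ste awt todot cntt Es.
have [T _] := explore_idle I ste awt.
set g := setn f t s; set net' := (X in inv _ X).
have gpar y : par (g y) = par (f y) by rewrite /g /setn Es; case: eqP => [->|].
have gcnt y : cnt (g y) = cnt (f y) by rewrite /g /setn Es; case: eqP => [->|].
have gchl y : chl (g y) = chl (f y) by rewrite /g /setn Es; case: eqP => [->|].
have gaw y : await (g y) = await (f y) by rewrite /g /setn Es; case: eqP => [->|].
have gtodo y : todo (g y) = todo (f y) by rewrite /g /setn Es; case: eqP => [->|].
have gN y : y <> t -> g y = f y by rewrite /g /setn; case: eqP.
have gstt : st (g t) = if cnt (f t) == #|V| - 1 then DONE else IDLE.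
  by rewrite /g /setn eqxx Es.
have gstt' : st (g t) <> EXPLORE /\ st (g t) <> INIT by rewrite gstt; case: eqP.
have pend0 v : pending f [::] t v = false by rewrite /pending todot awt inE.
have gI y : st (g y) = INIT <-> st (f y) = INIT.
  have [->|/eqP yt] := eqVneq y t; last by rewrite gN.
  by case: gstt' => _ n; split=> [/n|]; rewrite ?ste.
have gE y : st (g y) = EXPLORE -> y <> t /\ st (f y) = EXPLORE.
  by have [->|/eqP yt] := eqVneq y t; [case: gstt'|rewrite gN].
have gpend y v : pending g net' y v = pending f [::] y v.
  rewrite /pending gtodo gaw [in RHS]andbF; congr (_ || _).
  rewrite /net'; case: (par (f t)) => [p|]; last by rewrite andbF.
  by rewrite inE xpair_eqE; have [->|] := eqVneq y t; [rewrite awt|rewrite andbF].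
have gfresh y v : fresh f [::] y v -> fresh g net' y v.
  rewrite /fresh gcnt gpend; case=> [->|]; first by left.
  have [->|/eqP yt] := eqVneq y t; first by rewrite pend0 => -[].
  by rewrite gN //; right.
split.
- by rewrite gpar; have [? rI] := inv_root I; split=> // /gI.
- by move=> u /gI; rewrite gpar gcnt gchl; exact: (inv_init I).
- move=> u; rewrite gtodo gaw; have [->//|/eqP ut] := eqVneq u t.
  by rewrite gN //; exact: (inv_rest I).
- by move=> u p; rewrite gpar => /(inv_par I)[? ? n]; split=> // /gI.
- by move=> u ur su; rewrite gpar; apply: (inv_tree I) => // /gI.
- move=> u; have [->|/eqP ut] := eqVneq u t; last by rewrite gN //; exact: (inv_cnt I).
  have := inv_cnt I t; rewrite /cnt_ok gstt ste gcnt.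
  by case: eqP => //; lia.
- by move=> u v; rewrite gpar gtodo; exact: (inv_todo I).
- by move=> u v; rewrite gpar gtodo gaw; exact: (inv_awt I).
- by move=> u v; rewrite gchl gpar; exact: (inv_chl I).
- by move=> u v uv /gI sv; apply: gfresh; exact: (inv_unseen I).
- by move=> u v; rewrite gchl gpar => vu pv; apply: gfresh; exact: (inv_sib I).
- move=> u v uv /gI sv su; rewrite gchl; apply: (inv_chlI I) => //.
  by move=> /gI.
- by move=> u v; rewrite gpar gchl; exact: (inv_chlP I).
(* [late] does not change at [t], which ends in [DONE] exactly when it leaves a dummy loop. *)
- move=> u p; rewrite gpar !gcnt gpend => pu; have := inv_count I pu.
  have [pt|/eqP pt] := eqVneq p t; last by rewrite gN.
  rewrite pt in pu *; rewrite pend0 /late gstt ste.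
  have := inv_cnt I t; rewrite /cnt_ok ste => -[_ c].
  by case: (ph (f t)) cntt c => [[//|/eqP/negPf->]|_ /(_ erefl)->]; rewrite ?eqxx.
- move=> u /gE[ut su] ur; have [p [pu sp ap]] := inv_stack I su ur.
  exists p; rewrite gpar gaw gN // => pt.
  by move: ap; rewrite pt awt.
- have [_ ch _] := T.
  rewrite /net'; case pt : (par (f t)) => [p|]; last first.
    (* Without a parent, [t] is the root. It awaits nobody, so no other node can be exploring. *)
    left; split=> // u /gE[ut su].
    have [tr|/eqP tr] := eqVneq t r.
      by have [_] := explore_root I su; rewrite -tr => /(_ ut).
    by have [p] := inv_tree I tr ltac:(by rewrite ste); rewrite pt.
  have tr : t <> r by move=> tr; move: pt; rewrite tr (inv_root I).1.
  have [sp ap] := explore_parent I pt ste.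
  have npt : p <> t by move=> E; move: ap; rewrite E awt.
  right; exists p; split; first by rewrite gN.
    move=> u /gE[ut su] up; have [v [av sv pv]] := ch u su ut.
    exists v; rewrite gaw gpar gN // => vt.
    by move: pv; rewrite vt pt => -[pu]; apply: up.
  right; exists t; rewrite gaw; case: gstt' => ? ?.
  by split=> //; right.
Qed.

(** The form of the network covers both the root, which starts by itself, and a node called by its
    parent. *)
Lemma explore_step f x s :
  inv f (if par (f x) is Some t then [:: (t, x)] else [::]) -> st (f x) = IDLE ->
  s = start_explore adj x (f x) -> inv (setn f x s) [::].
Proof.
set net := (X in inv _ X) => I sx Es.
have sxE : st (f x) <> EXPLORE by rewrite sx.
have [todox awx] := inv_rest I sxE.
have req t : par (f x) = Some t ->
    [/\ token f net t, st (f t) = EXPLORE & await (f t) = Some x].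
  move=> pt; have tx : (t, x) \in net by rewrite /net pt mem_head.
  by have [] := request_sender I tx sxE.
set g := setn f x s.
have gpar y : par (g y) = par (f y) by rewrite /g /setn Es; case: eqP => [->|].
have gchl y : chl (g y) = chl (f y) by rewrite /g /setn Es; case: eqP => [->|].
have gaw y : await (g y) = await (f y) by rewrite /g /setn Es; case: eqP => [->|].
have gN y : y <> x -> g y = f y by rewrite /g /setn; case: eqP.
have gx : g x = s by rewrite /g /setn eqxx.
have gtodo v : (v \in todo (g x)) = adj x v && (par (f x) != Some v).
  rewrite gx Es /= !inE andbC; congr andb.
  by case: (par (f x)) => [p|]; rewrite inE // eq_sym.
have gI y : st (g y) = INIT <-> st (f y) = INIT.
  by have [->|/eqP yx] := eqVneq y x; [rewrite gx Es sx|rewrite gN].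
have netP y v : (y, v) \in net -> par (f x) = Some y /\ v = x.
  rewrite /net; case: (par (f x)) => [t|//]; rewrite inE.
  by case/eqP=> -> ->.
have gpend y v : y <> x -> ~ (par (f x) = Some y /\ v = x) ->
    pending g [::] y v = pending f net y v.
  move=> yx n; rewrite (pendingE _ (net := net)); first by rewrite /pending gN // andbF orbF.
  by apply/negP => /netP.
have gfresh y v : ~ (par (f x) = Some y /\ v = x) -> adj y v ->
    (y = x -> par (f x) <> Some v) -> fresh f net y v -> fresh g [::] y v.
  move=> n yv nv; have [yx|/eqP yx] := eqVneq y x; last by rewrite /fresh gN // gpend.
  rewrite yx in yv nv *; case=> [c0|[]]; last by rewrite sx.
  right; rewrite gx Es /= c0; split=> //.
  by rewrite /pending gtodo yv; case: eqP => // /(nv erefl).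
split.
- by rewrite gpar; have [? rI] := inv_root I; split=> // /gI.
- move=> u; rewrite gpar gchl => su; rewrite gN; first by apply: (inv_init I); apply/gI.
  by move=> ux; move: su; rewrite ux gx Es.
- move=> u; have [->|/eqP ux] := eqVneq u x; first by rewrite gx Es.
  by rewrite gN //; exact: (inv_rest I).
- by move=> u p; rewrite gpar => /(inv_par I)[? ? n]; split=> // /gI.
- by move=> u ur su; rewrite gpar; apply: (inv_tree I) => // /gI.
- move=> u; have [->|/eqP ux] := eqVneq u x; last by rewrite gN //; exact: (inv_cnt I).
  by have := inv_cnt I x; rewrite /cnt_ok gx Es sx /=; split=> //; lia.
- move=> u v; rewrite gpar; have [->|/eqP ux] := eqVneq u x.
    by rewrite gtodo => /andP[-> /eqP].
  by rewrite gN //; exact: (inv_todo I).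
- move=> u v; rewrite gpar gaw; have [->|/eqP ux] := eqVneq u x; first by rewrite awx.
  by rewrite gN //; exact: (inv_awt I).
- by move=> u v; rewrite gchl gpar; exact: (inv_chl I).
- move=> u v uv /gI sv; apply: gfresh => //; last exact: (inv_unseen I).
    by move=> [_ vx]; rewrite vx sx in sv.
  by move=> _ /(inv_par I)[].
- move=> u v; rewrite gchl gpar => vu pv; have [uv puv] := inv_chl I vu.
  apply: gfresh; [|by rewrite adj_sym| |exact: (inv_sib I)].
    by move=> [px ux]; apply: puv; rewrite ux.
  by move=> vx; rewrite -vx.
- move=> u v uv /gI sv su; rewrite gchl; apply: (inv_chlI I) => //.
  by move=> /gI.
- by move=> u v; rewrite gpar gchl; exact: (inv_chlP I).
(* Towards its children, the new count of [x] is balanced by their becoming pending; towards its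
   parent, by the pending request being consumed. *)
- move=> u p; rewrite gpar => pu; have := inv_count I pu.
  have [adpu Dup sp] := inv_par I pu.
  have [px|/eqP px] := eqVneq p x.
    rewrite px in pu adpu Dup *.
    have ux : u <> x by move=> ux; move: Dup; rewrite ux; lia.
    have pxu : par (f x) != Some u.
      by apply/eqP => /(inv_par I)[_ Dx _]; lia.
    rewrite (gN u) // /pending todox awx gtodo adpu pxu inE /= gx Es /late sx /= => ->; lia.
  rewrite (gN p) //; have [ux|/eqP ux] := eqVneq u x; last first.
    by rewrite (gN u) // gpend // => -[_].
  rewrite ux in pu *; have [_ _ awp] := req p pu; have [_ _ /negPf xp] := inv_awt I awp.
  rewrite {1}/pending xp awp eqxx /net pu mem_head /= => ->.
  by rewrite gx Es /= /pending gN // xp ?in_nil ?andbF /=; lia.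
- move=> u; have [->|/eqP ux] := eqVneq u x.
    move=> _ xr; have [t pt] := inv_tree I xr ltac:(by rewrite sx).
    have [_ ste awt] := req t pt; exists t; rewrite gpar gaw gN // => tx.
    by rewrite tx in ste.
  rewrite gN // => su ur; have [p [pu sp ap]] := inv_stack I su ur.
  exists p; rewrite gN // => px.
  by rewrite px in sp.
- right; exists x; split; [by rewrite gx Es| |by left; rewrite gaw].
  move=> u + ux; rewrite gN // => su.
  have [q pq] : exists q, par (f x) = Some q.
    have [xr|/eqP xr] := eqVneq x r; last by apply: (inv_tree I) xr _; rewrite sx.
    by have [] := explore_root I su; rewrite -xr.
  have [[_ ch _] sq awq] := req q pq.
  have [uq|/eqP uq] := eqVneq u q.
    by exists x; rewrite gpar uq gx Es.
  have [v [? sv ?]] := ch u su uq; exists v; rewrite gpar gN // => vx.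
  by rewrite vx in sv.
Qed.

(** Here the tree grows. As [w] is unseen, [t] is in its first regular loop; by [layer_seen] all
    nodes of depth at most [D t] have joined, so [w] lies exactly one layer below [t]. *)
Lemma set_parent_step f t w s : 1 < #|V| -> inv f [:: (t, w)] -> st (f w) = INIT ->
  s = NState IDLE (Some t) (nbrs adj w :\ t) 0 Reg set0 None ->
  inv (setn f w s) [:: (w, t)].
Proof.
move=> card_gt1 I sw Es.
have swE : st (f w) <> EXPLORE by rewrite sw.
have [T ste awt _] := request_sender I (mem_head _ _) swE.
have [tw ptw wtodo] := inv_awt I awt.
have [_ aww] := inv_rest I swE.
have [parw cntw chlw] := inv_init I sw.
have wt : w <> t by move=> E; rewrite E ste in sw.
have [cntt pht] : cnt (f t) = 1 /\ ph (f t) = Reg.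
  have [c0|[]//] := inv_unseen I tw sw.
  by have := inv_cnt I t; rewrite /cnt_ok ste c0 => -[].
have Dw : D w = (D t).+1.
  have := dist_adj DP tw; suff: ~~ (D w <= D t) by lia.
  by apply/negP => Dw; apply: layer_seen Dw sw; [exact: I|rewrite cntt].
set g := setn f w s.
have gN y : y <> w -> g y = f y by rewrite /g /setn; case: eqP.
have gw : g w = s by rewrite /g /setn eqxx.
have gI y : st (g y) = INIT -> y <> w /\ st (f y) = INIT.
  by have [->|/eqP yw] := eqVneq y w; [rewrite gw Es|rewrite gN].
have fI y : st (f y) <> INIT -> st (g y) <> INIT by move=> n /gI[].
have noch y p : par (f y) = Some p -> p <> w.
  by move=> /(inv_par I)[_ _ +] pw; rewrite pw sw.
have gpend y v : y <> w -> ~ (y = t /\ v = w) ->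
    pending g [:: (w, t)] y v = pending f [:: (t, w)] y v.
  move=> yw n; rewrite /pending gN // !inE !xpair_eqE; congr (_ || (_ && _)).
  have -> : (y == t) && (v == w) = false by apply/negP => /andP[/eqP ? /eqP ?]; apply: n.
  by move/eqP/negPf: yw => ->.
have gfresh y v : ~ (y = t /\ v = w) -> fresh f [:: (t, w)] y v -> fresh g [:: (w, t)] y v.
  move=> n; have [->|/eqP yw] := eqVneq y w; first by left; rewrite gw Es.
  by rewrite /fresh gN // gpend.
split.
- by rewrite gN; [exact: (inv_root I)|move=> rw; have [_] := inv_root I; rewrite rw].
- by move=> u /gI[uw su]; rewrite gN //; exact: (inv_init I).
- move=> u; have [->|/eqP uw] := eqVneq u w; first by rewrite gw Es.
  by rewrite gN //; exact: (inv_rest I).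
- move=> u p; have [->|/eqP uw] := eqVneq u w.
    by rewrite gw Es => -[<-]; split=> //; apply: fI; rewrite ste.
  by rewrite (gN u) // => /(inv_par I)[? ? n]; split=> //; apply: fI.
- move=> u ur; have [->|/eqP uw] := eqVneq u w; first by rewrite gw Es; exists t.
  by rewrite gN //; exact: (inv_tree I).
- move=> u; have [->|/eqP uw] := eqVneq u w; last by rewrite gN //; exact: (inv_cnt I).
  (* The count 0 must be short of [#|V| - 1], whence [1 < #|V|]. *)
  by rewrite /cnt_ok gw Es /= subn_gt0.
- move=> u v; have [->|/eqP uw] := eqVneq u w; first by rewrite gw Es inE.
  by rewrite gN //; exact: (inv_todo I).
- move=> u v; have [->|/eqP uw] := eqVneq u w; first by rewrite gw Es.
  by rewrite gN //; exact: (inv_awt I).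
- move=> u v; have [->|/eqP uw] := eqVneq u w.
    by rewrite gw Es !inE => /andP[vt ->]; split=> // -[tv]; rewrite tv eqxx in vt.
  by rewrite gN //; exact: (inv_chl I).
- move=> u v uv /gI[vw sv]; apply: gfresh; last exact: (inv_unseen I).
  by case.
- move=> u v vu pv.
  have [vw|/eqP vw] := eqVneq v w; first by left; rewrite vw gw Es.
  rewrite gN // in pv.
  have [uw|/eqP uw] := eqVneq u w; last first.
    by apply: gfresh; [case|rewrite gN // in vu; exact: (inv_sib I)].
  rewrite uw in vu pv *; move: vu; rewrite gw Es !inE => /andP[vt wv].
  apply: gfresh; first by case=> vt'; rewrite vt' eqxx in vt.
  by apply: (inv_unseen I) => //; rewrite adj_sym.
- move=> u v uv /gI[vw sv]; have [uw|/eqP uw] := eqVneq u w.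
    rewrite uw in uv *; rewrite gw Es /= => _; rewrite !inE uv andbT.
    by apply/eqP => vt; rewrite vt ste in sv.
  by rewrite gN //; exact: (inv_chlI I).
- move=> u v; have [->|/eqP vw] := eqVneq v w.
    by rewrite gw Es => -[<-]; rewrite gN; [apply: (inv_chlI I)|move/esym] => //; rewrite ste.
  by rewrite gN // => pv; rewrite gN; [exact: (inv_chlP I)|exact: noch pv].
- move=> u p; have [->|/eqP uw] := eqVneq u w.
    rewrite gw Es => -[<-] /=; rewrite gN; last by move/esym.
    rewrite cntt /pending gN; last by move/esym.
    rewrite (negPf wtodo) !inE xpair_eqE /late ste pht /=.
    by move/eqP/negPf: (wt); rewrite eq_sym => ->; rewrite /= andbF.
  rewrite (gN u) // => pu; have pw := noch _ _ pu.
  by rewrite (gN p) // gpend //; [exact: (inv_count I)|case].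
- move=> u; have [->|/eqP uw] := eqVneq u w; first by rewrite gw Es.
  rewrite gN // => su ur; have [p [pu sp ap]] := inv_stack I su ur.
  by exists p; rewrite gN //; exact: noch pu.
- right; exists t; have [_ ch _] := T; split; first by rewrite gN //; exact: nesym.
    move=> u; have [->|/eqP uw] := eqVneq u w; first by rewrite gw Es.
    rewrite gN // => su ut; have [v [? sv ?]] := ch u su ut.
    by exists v; rewrite gN // => vw; rewrite vw in sv.
  right; exists w; rewrite gw Es gN; last exact: nesym.
  by split=> //; right.
Qed.

Lemma inv_start : 1 < #|V| -> inv (init_state adj r) [::].
Proof.
move=> card_gt1.
have pr u : par (init_state adj r u) = None by rewrite /init_state; case: eqP.
have aw u : await (init_state adj r u) = None by rewrite /init_state; case: eqP.
have td u : todo (init_state adj r u) = set0 by rewrite /init_state; case: eqP.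
have c0 u : cnt (init_state adj r u) = 0 by rewrite /init_state; case: eqP.
have nE u : st (init_state adj r u) <> EXPLORE by rewrite /init_state; case: eqP.
have rI u : st (init_state adj r u) <> INIT -> u = r by rewrite /init_state; case: eqP.
split=> //; try by [move=> u p; rewrite pr | move=> u v; rewrite td inE
  | move=> u v; rewrite aw | move=> *; left].
- by rewrite pr /init_state eqxx.
- by move=> u su; split=> //; move: su; rewrite /init_state; case: eqP.
- by move=> u ur /rI.
- by move=> u; rewrite /cnt_ok /init_state; case: eqP => //= _; rewrite subn_gt0.
- by move=> u v; rewrite pr /init_state; case: eqP => [->|_] /=; rewrite inE.
- by move=> u v uv _ /rI ur; move: uv; rewrite ur /init_state eqxx /= inE.
- by move=> u /nE.
Qed.

(** * Potential and termination *)

Notation deg u := #|nbrs adj u|.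

(* Each node still owes [#|V| - 1 - cnt] explorations; one of them costs at most
   [3 * deg] steps for its regular loop (send, answer, receive), as much for its
   dummy loop, and [3] steps to start the two loops and to finish. *)
Definition weight u (s : nstate V) : nat :=
  (#|V| - 1 - cnt s) * (6 * deg u + 3) + 3 * #|todo s| + (await s != None)
  + match st s, ph s with
    | EXPLORE, Reg => 3 * deg u + 2
    | EXPLORE, Dum => 1
    | _, _ => 0
    end.

Definition potential (f : V -> nstate V) (net : seq (V * V)) : nat :=
  \sum_u weight u (f u) + count (fun m => await (f m.1) == Some m.2) net.

Lemma potential_setn f net x s net' :
  weight x s + count (fun m => await (setn f x s m.1) == Some m.2) net' <
  weight x (f x) + count (fun m => await (f m.1) == Some m.2) net ->
  potential (setn f x s) net' < potential f net.
Proof.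
move=> lt; rewrite /potential (bigD1 x) //= [X in _ < X + _](bigD1 x) //=.
rewrite {1}/setn eqxx; under eq_bigr => u ux do rewrite /setn (negPf ux).
by rewrite addnAC [ltnRHS]addnAC ltn_add2r.
Qed.

Lemma weight_explore u (s : nstate V) : st s = IDLE -> cnt s < #|V| - 1 ->
  weight u (start_explore adj u s) < weight u s.
Proof.
move=> su lt; rewrite /weight su /=.
have := subset_leq_card (subsetDl (nbrs adj u) (pset (par s))).
have -> : #|V| - 1 - cnt s = (#|V| - 1 - (cnt s).+1).+1 by lia.
move: (#|V| - 1 - _) #|nbrs adj u :\: pset (par s)| (deg u) => a b d bd.
by rewrite mulSn addn0; lia.
Qed.

(** At most one message is sent while the potential falls, so [sent] plus potential never grows. *)
Lemma step_inv c c' : 1 < #|V| -> inv (ns c) (net c) -> step adj r c c' ->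
  [/\ inv (ns c') (net c'), potential (ns c') (net c') < potential (ns c) (net c)
    & sent c' <= (sent c).+1].
Proof.
move=> card_gt1 I ST; case: ST I => {c c'} [c sr|c v u vu su|c v u vu su pu /=|c v u vu su pu
  |c v u vu su au /=|c u w su au wu /=|c u su au phu tu cu /=|c u su au tu cu /=] I.
- have srE : st (ns c r) <> EXPLORE by rewrite sr.
  have [_ N] := idle_root_quiet I srE; have [tr ar] := inv_rest I srE.
  have [pr _] := inv_root I; have cr := inv_cnt I r; rewrite /cnt_ok sr in cr.
  rewrite /= N in I *; split=> //; first by apply: explore_step sr erefl; rewrite pr.
  by apply: potential_setn; rewrite /= !addn0; exact: weight_explore.
- have suE : st (ns c u) <> EXPLORE by rewrite su.
  have [T sv av N] := request_sender I vu suE; have [tu au] := inv_rest I suE.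
  have [_ c0 _] := inv_init I su.
  rewrite /= N /= eqxx /= in I *; split=> //; first exact: set_parent_step card_gt1 I su erefl.
  apply: potential_setn; rewrite /= /setn eqxx /= av eqxx /weight su tu au c0 /=; lia.
- have suE : st (ns c u) <> EXPLORE by case: su => ->.
  have [T sv av N] := request_sender I vu suE; have [tu au] := inv_rest I suE.
  rewrite /= N /= eqxx /= in I *; split=> //; first exact: sibling_step I su pu erefl.
  by apply: potential_setn; rewrite /= /setn eqxx /= av au eqxx /weight /=; lia.
- have suE : st (ns c u) <> EXPLORE by rewrite su.
  have [T sv av N] := request_sender I vu suE; have [tu au] := inv_rest I suE.
  rewrite /= N /= eqxx /= in I *; split=> //.
    by apply: explore_step su erefl; rewrite pu.
  have cu := inv_cnt I u; rewrite /cnt_ok su in cu.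
  apply: potential_setn; rewrite /= addn0; apply: leq_trans (weight_explore _ su cu) _.
  exact: leq_addr.
- have [T _ sv _ N] := reply_receiver I vu su.
  rewrite /= N /= eqxx /= in I *; split=> //; first exact: receive_step I su erefl.
  by apply: potential_setn; rewrite /= /weight su au /=; lia.
- have [T N] := explore_idle I su au.
  rewrite N /= in I *; split=> //; first exact: send_step I su au wu erefl.
  apply: potential_setn; rewrite /= /setn eqxx /= eqxx /weight su au /=.
  by rewrite (cardsD1 w (todo _)) wu; lia.
- have [T N] := explore_idle I su au.
  rewrite N /= in I *; split=> //; first exact: dummy_step I su au phu tu cu erefl.
  have := subset_leq_card (_ : chl (ns c u) \subset nbrs adj u).
  have -> : chl (ns c u) \subset nbrs adj u.
    by apply/subsetP => v /(inv_chl I)[uv _]; rewrite inE.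
  move=> /(_ isT) le; apply: potential_setn; rewrite /= /weight su au phu /=; lia.
- have [T N] := explore_idle I su au.
  rewrite N cats0 /= in I *; split; last by case: (par _).
    exact: finish_step I su au tu cu erefl.
  apply: potential_setn; rewrite /weight su au tu /= !cards0 !addn0.
  rewrite (_ : count _ _ = 0); last first.
    by case: (par _) => //= p; rewrite /setn eqxx.
  by case: eqP => _; case: (ph (ns c u)); lia.
Qed.

Lemma reachable_inv c : 1 < #|V| -> reachable adj r c ->
  inv (ns c) (net c) /\
  sent c + potential (ns c) (net c) <= potential (init_state adj r) [::].
Proof.
move=> card_gt1; elim=> [|{}c c' _ [I le] ST]; first by split; [exact: inv_start|].
have [I' lt sc] := step_inv card_gt1 I ST; split=> //; apply: leq_trans le; lia.
Qed.

Lemma potential_start : (forall u, 0 < deg u) ->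
  potential (init_state adj r) [::] <= 36 * #|V| * n_edges adj.
Proof.
move=> deg_gt0; rewrite /potential addn0.
(* Degrees are positive, so [6 * deg + 3] is at most [9 * deg]; the degree sum contributes the
   remaining factor 4 of 36. *)
apply: (@leq_trans (\sum_u 9 * #|V| * deg u)).
  apply: leq_sum => u _; have := deg_gt0 u => d0.
  have -> : weight u (init_state adj r u) = (#|V| - 1) * (6 * deg u + 3).
    by rewrite /weight /init_state; case: eqP => _ /=; rewrite cards0 subn0 !addn0.
  by rewrite mulnAC mulnC leq_mul //; lia.
rewrite -big_distrr /= -[36]/(9 * 4) -!mulnA [4 * _]mulnCA leq_mul2l /= leq_mul2l.
by rewrite card_adj_pairs orbT.
Qed.

(** * Final configurations and absence of deadlock *)

(** Completion spreads down the tree: when nothing is pending, a child of a node in [DONE] has the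
    same count [#|V| - 1], which [IDLE] forbids. *)
Lemma terminal_done f net : inv f net -> quiet f net -> st (f r) = DONE ->
  forall u, [/\ st (f u) <> INIT, cnt (f u) = #|V| - 1 &
    u <> r -> exists p, [/\ par (f u) = Some p, adj p u & D u = (D p).+1]].
Proof.
move=> I [nE _] sr u.
have rr : rounds (f r) = #|V| - 1.
  by have := inv_cnt I r; rewrite /cnt_ok /rounds sr.
have seen v : st (f v) <> INIT by apply: (rounds_ge I _).1; rewrite rr dist_le_card.
have par_ex v : v <> r -> exists p, [/\ par (f v) = Some p, adj p v & D v = (D p).+1].
  by move=> vr; have [p pv] := inv_tree I vr (seen v); have [? ?] := inv_par I pv; exists p.
suff: st (f u) = DONE.
  by move=> su; have := inv_cnt I u; rewrite /cnt_ok su; split=> //; exact: par_ex.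
move Du: (D u) => k; elim: k u Du => [|k IH] u Du.
  by rewrite (dist_eq0 DP Du).
have [p [pu _ Dp]] : exists p, [/\ par (f u) = Some p, adj p u & D u = (D p).+1].
  by apply: par_ex => ur; move: Du; rewrite ur (dist_root DP).
have sp := IH p ltac:(lia); have := inv_count I pu.
have := inv_cnt I p; rewrite /cnt_ok /late /pending sp => ->.
have [-> ->] := inv_rest I (nE p); rewrite inE /= !addn0 => cu.
have := inv_cnt I u; rewrite /cnt_ok -cu; case su : (st (f u)) => //.
- by have := seen u.
- by rewrite ltnn.
- by have := nE u.
Qed.

(** Wherever the token is, some step is enabled; and a quiet network with an idle root lets the root
    start again. *)
Lemma terminal_quiet c : inv (ns c) (net c) -> terminal adj r c ->
  quiet (ns c) (net c) /\ st (ns c r) = DONE.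
Proof.
move=> I TC.
have Q : quiet (ns c) (net c).
  case: (inv_ctrl I) => // -[t [ste _ []]].
    move=> [awt N]; exfalso.
    have [td0|[w wt]] := set_0Vmem (todo (ns c t)); last first.
      exact: (TC _ (StepSendNext adj r ste awt wt)).
    case pt : (ph (ns c t)); last exact: (TC _ (StepFinish adj r ste awt td0 (or_introl pt))).
    have [ct|/eqP ct] := eqVneq (cnt (ns c t)) (n_nodes V - 1).
      exact: (TC _ (StepStartDummy adj r ste awt pt td0 ct)).
    exact: (TC _ (StepFinish adj r ste awt td0 (or_intror ct))).
  move=> [w [awt sw]]; case=> [N|[N sI]]; exfalso; last first.
    have wt : (w, t) \in net c by rewrite N mem_head.
    exact: (TC _ (StepReceiveAwaited adj r wt ste awt)).
  have tw : (t, w) \in net c by rewrite N mem_head.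
  case E : (st (ns c w)).
  - exact: (TC _ (StepSetParent adj r tw E)).
  - have [pw|/eqP pw] := eqVneq (par (ns c w)) (Some t).
      exact: (TC _ (StepExplore adj r tw E pw)).
    exact: (TC _ (StepMarkSibling adj r tw (or_introl E) pw)).
  - by [].
  - have [pw|/eqP pw] := eqVneq (par (ns c w)) (Some t).
      (* A node in [DONE] gets no request from its parent: with the request pending, the count of
         [t] would exceed [#|V| - 1]. *)
      have := inv_count I pw; have := inv_cnt I w; rewrite /cnt_ok E => ->.
      have := cnt_le I t; rewrite /pending awt eqxx tw orbT; lia.
    exact: (TC _ (StepMarkSibling adj r tw (or_intror E) pw)).
split=> //; case E : (st (ns c r)) => //.
- by have [_] := inv_root I; rewrite E.
- by case: (TC _ (StepRootExplore _ E)).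
- by case: Q => /(_ r).
Qed.

End Invariant.

(** * Positive degrees, and assembly of the three claims *)

Lemma deg_gt0 (V : finType) (adj : rel V) (u : V) :
  (forall v, connect adj u v) -> 1 < #|V| -> 0 < #|nbrs adj u|.
Proof.
move=> conn /card_gt1P[x [y [_ _ xy]]].
have [v vu] : exists v, v != u.
  by have [xu|xu] := eqVneq x u; [exists y; rewrite -xu eq_sym|exists x].
have /connectP[[|w p] /=] := conn v; first by move=> _ E; rewrite E eqxx in vu.
by case/andP=> uw _ _; apply/card_gt0P; exists w; rewrite inE.
Qed.

Theorem mainTheorem4 :
  exists C : nat,
  forall (V : finType) (adj : rel V) (r : V),
    symmetric adj -> irreflexive adj ->
    (forall u v : V, connect adj u v) ->
    1 < #|V| ->
    (* termination: there is no infinite execution *)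
    ~ (exists f : nat -> config V,
         f 0 = init_config adj r /\ forall i, step adj r (f i) (f i.+1)) /\
    (* every execution stops only in a proper final configuration *)
    (forall c : config V, reachable adj r c -> terminal adj r c ->
       st (ns c r) = DONE /\ net c = [::] /\
       par (ns c r) = None /\
       (forall (u : V) (k : nat), u != r -> is_dist adj r u k ->
          exists p : V, par (ns c u) = Some p /\ adj u p /\ is_dist adj r p k.-1) /\
       (forall u : V, chl (ns c u) = [set v | par (ns c v) == Some u])) /\
    (* O(nm) messages *)
    (forall c : config V, reachable adj r c ->
       sent c <= C * n_nodes V * n_edges adj).
Proof.
exists 36 => V adj r adj_sym adj_irr conn card_gt1.
have [D DP] := dist_exists (conn r).
have RI c := @reachable_inv _ _ _ adj_sym adj_irr _ DP c card_gt1.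
have start_le : potential adj (init_state adj r) [::] <= 36 * #|V| * n_edges adj.
  by apply: potential_start => u; exact: deg_gt0.
split=> [[f [f0 fS]]|]; last split.
- have Rf i : reachable adj r (f i).
    by elim: i => [|i R]; [rewrite f0; constructor|exact: reach_step R (fS i)].
  pose p i := potential adj (ns (f i)) (net (f i)).
  have lt i : p i.+1 < p i.
    by have [I _] := RI _ (Rf i); have [] := step_inv adj_sym adj_irr DP card_gt1 I (fS i).
  have bd i : p i + i <= p 0 by elim: i => [|i]; [rewrite addn0|have := lt i; lia].
  by have := bd (p 0).+1; lia.
- move=> c /RI[I _] TC; have [Q sr] := terminal_quiet I TC.
  have done_ := terminal_done DP I Q sr; have [nE N] := Q.
  split=> //; split=> //; split; first by case: (inv_root I).
  split=> [u k /eqP ur uk|u].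
    have [_ _ /(_ ur)[p [pu pu' Dup]]] := done_ u; exists p; rewrite adj_sym; split=> //.
    by split=> //; rewrite (is_dist_inj uk (DP u)) Dup; exact: DP.
  apply/setP => v; rewrite inE; apply/idP/eqP => [vu|]; last exact: (inv_chlP I).
  (* Were [v] not a tree child, it would be fresh towards [u]; with nobody exploring this means
     count 0, against the final count [#|V| - 1]. *)
  case: (par (ns c v) =P Some u) => // pv; case: (inv_sib I vu pv) => [c0|[/nE]//].
  by have [_ cv _] := done_ v; lia.
- by move=> c /RI[_ le]; apply: leq_trans start_le; apply: leq_trans le; exact: leq_addr.
Qed.
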